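(* There are infinitely many elliptic curves of the form $$E_t:\ y^2=x^3-(t^2-1)^2x+(2t)^2,\qquad t\in\mathbb{Q},$$ with rank $\geq 3$; that is, there are infinitely many $t\in\mathbb{Q}$ for which $E_t$ is an elliptic curve over $\mathbb{Q}$ of rank at least $3$.
   Context: The rank of an elliptic curve $E$ over $\mathbb{Q}$ is the nonnegative integer $r$ such that $E(\mathbb{Q})\cong\mathbb{Z}^r\times E(\mathbb{Q})_{\mathrm{tors}}$. *)

(* Defs.v *)
From mathcomp Require Import all_boot all_order all_algebra.
From mathcomp Require Import ring.
From mathcomp Require Import boolp classical_sets functions cardinality.

Set Implicit Arguments.
Unset Strict Implicit.
Unset Printing Implicit Defensive.

Import GRing.Theory.

Local Open Scope classical_set_scope.
Local Open Scope ring_scope.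

(* Short Weierstrass curves y^2 = x^3 + a x + b, used in characteristic
   different from 2 and 3. *)
Section Weierstrass.
Variable F : fieldType.
Implicit Types a b x y : F.

Definition discriminant a b : F := - 16 * (4 * a ^+ 3 + 27 * b ^+ 2).

Definition elliptic a b : bool := discriminant a b != 0.

(* [None] is the point at infinity. *)
Definition on_curve a b (P : option (F * F)) : bool :=
  if P is Some (x, y) then y ^+ 2 == x ^+ 3 + a * x + b else true.

Definition slope a x1 y1 x2 y2 : F :=
  if x1 == x2 then (3 * x1 ^+ 2 + a) / (2 * y1) else (y2 - y1) / (x2 - x1).

(* Chord-and-tangent addition. *)
Definition add_raw a (P Q : option (F * F)) : option (F * F) :=
  match P, Q with
  | None, _ => Q
  | _, None => P
  | Some (x1, y1), Some (x2, y2) =>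
      if (x1 == x2) && (y1 == - y2) then None else
      let l := slope a x1 y1 x2 y2 in
      let x3 := l ^+ 2 - x1 - x2 in
      Some (x3, l * (x1 - x3) - y1)
  end.

Lemma on_curve_add a b P Q :
  on_curve a b P -> on_curve a b Q -> on_curve a b (add_raw a P Q).
Proof.
case: P => [[x1 y1]|]; case: Q => [[x2 y2]|] //= /eqP e1 /eqP e2.
case: ifP => //= nPQ; rewrite /slope; apply/eqP.
case: eqVneq nPQ e2 => [<-{x2}|ne] /= nPQ e2.
  have yy : y1 = y2.
    have /eqP : (y1 - y2) * (y1 + y2) = 0.
      by rewrite -subr_sqr e1 e2 subrr.
    by rewrite mulf_eq0 subr_eq0 addr_eq0 nPQ orbF => /eqP.
  subst y2; have y2n0 : 2 * y1 != 0.
    by rewrite mulr_natl mulr2n addr_eq0 nPQ.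
  set l := _ / _.
  have hl : l * (2 * y1) = 3 * x1 ^+ 2 + a by rewrite /l divfK.
  have -> : b = y1 ^+ 2 - x1 ^+ 3 - a * x1 by rewrite e1; ring.
  have -> : a = l * (2 * y1) - 3 * x1 ^+ 2 by rewrite hl; ring.
  by ring.
have dn0 : x2 - x1 != 0 by rewrite subr_eq0 eq_sym.
set l := _ / _.
have hl : y2 = y1 + l * (x2 - x1) by rewrite /l divfK //; ring.
have ha : a = l * (y1 + y2) - (x1 ^+ 2 + x1 * x2 + x2 ^+ 2).
  apply: (mulIf dn0).
  have -> : a * (x2 - x1) = (x2 ^+ 3 + a * x2 + b) - (x1 ^+ 3 + a * x1 + b)
                           - (x2 ^+ 3 - x1 ^+ 3) by ring.
  by rewrite -e1 -e2 hl; ring.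
have -> : b = y1 ^+ 2 - x1 ^+ 3 - a * x1 by rewrite e1; ring.
by rewrite ha hl; ring.
Qed.

(* E(F), for E : y^2 = x^3 + a x + b. *)
Definition ecpoint a b : Type := {P : option (F * F) | on_curve a b P}.

Definition ec_zero a b : ecpoint a b := exist (on_curve a b) None isT.

Definition ec_add a b (P Q : ecpoint a b) : ecpoint a b :=
  exist (on_curve a b) _ (on_curve_add (valP P) (valP Q)).

Definition ec_torsion a b : set (ecpoint a b) :=
  [set P | exists2 n : nat, (0 < n)%N & iter n (ec_add P) (ec_zero a b) = ec_zero a b].

End Weierstrass.

(* E(Q) is isomorphic to Z^r x E(Q)_tors: [f] is bijective from E(Q) onto
   Z^r x E(Q)_tors (viewed inside Z^r x E(Q)) and carries the group law to the
   componentwise one. *)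
Definition has_rank (a b : rat) (r : nat) : Prop :=
  exists f : ecpoint a b -> 'rV[int]_r * ecpoint a b,
    set_bij [set: ecpoint a b]
            ([set: 'rV[int]_r] `*` @ec_torsion rat a b) f /\
    forall P Q, f (ec_add P Q) = ((f P).1 + (f Q).1, ec_add (f P).2 (f Q).2).

(* "The rank is at least n".  The rank is the r with [has_rank a b r]; that r
   exists is the Mordell-Weil theorem.  The second clause, that Z^n embeds in
   E(Q), follows from the first one and Mordell-Weil (and implies the first);
   it makes the definition meaningful without appealing to that theorem. *)
Definition rank_ge (a b : rat) (n : nat) : Prop :=
  (forall r, has_rank a b r -> (n <= r)%N) /\
  exists g : 'rV[int]_n -> ecpoint a b,
    injective g /\ forall u v, g (u + v) = ec_add (g u) (g v).

(* Main.v *)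
Require Import Defs.
From HB Require Import structures.
From mathcomp Require Import all_boot all_order all_algebra all_field.
From mathcomp Require Import ring lra zify.
From mathcomp Require Import boolp classical_sets functions cardinality.

(** The curve E_t : y^2 = x^3 - (t^2-1)^2 x + (2t)^2 always contains the points
    P1 = (0, 2t) and P2 = (t^2-1, 2t).  At x = -1 the cubic takes the value
    t^2 (t^2+2), so that P3 = (-1, tw) is a third point as soon as
    w^2 = t^2 + 2.  This conic has the rational parametrization
    t = (s^2-2)/(2s), w = (s^2+2)/(2s), and the theorem follows if P1, P2, P3
    are independent for infinitely many s.

    Independence is a 2-descent that only uses congruences.  If E(Q) has no
    point of order 2, then a nontrivial integral relation between the points can
    be halved until some coefficient is odd, and it then says that a nonempty
    subset of {P1, P2, P3} has its sum in 2E(Q) ([indep_mod2]).  A point with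
    abscissa X is a double only if the quartic
      x^4 - 2a x^2 - 8b x + a^2 - 4X (x^3 + ax + b)
    has a rational root ([ec_double_root]).  After scaling, this quartic is monic
    with integral coefficients, so that its rational roots are integers, and one
    prime modulo which it has no root excludes them all ([no_rat_root_modp]).
    Such an exclusion depends on s modulo that prime only.  For s = 61 mod 1105,
    the prime 5 excludes the points of order 2, the prime 13 excludes P1 + P2,
    and the prime 17 excludes the six other subset sums ([member_no_root] and
    [no_half_sums]).  This leaves infinitely many s.

    The absence of points of order 2 also makes the group law tractable.  Three
    points P, Q, R, no two of them opposite, lie on a unique curve k y = h(x)
    with h a monic quadratic polynomial, tangency being counted by the
    divisibility of h^2 - k^2 f by (x-xP)(x-xQ)(x-xR), where f is the cubic.  The
    fourth intersection of this curve with E is -((P+Q)+R)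
    ([add_interpolates]).  Since P, Q and R play symmetric roles in the
    uniqueness of the curve ([interpolates_uniq]), addition is associative
    ([add_rawA]).

    Finally, an embedding of Z^n into E(Q) forces n <= r whenever E(Q) is
    isomorphic to Z^r times its torsion: the kernel of the projection to Z^r is
    torsion, hence meets the image of Z^n trivially, and Z^n embeds into Z^r
    ([has_rank_geq]). *)

Set Implicit Arguments.
Unset Strict Implicit.
Unset Printing Implicit Defensive.

Import Order.TTheory GRing.Theory Num.Theory.

Local Open Scope classical_set_scope.
Local Open Scope ring_scope.

(** * The cubic and the halving quartic *)

Definition weierstrass_poly (R : nzRingType) (a b : R) : {poly R} :=
  'X^3 + a%:P * 'X + b%:P.

(** For a nonsingular curve over a field, its roots are the abscissas of the
    points Q, over an algebraic closure, such that 2Q has abscissa X. *)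
Definition halving_poly (R : comNzRingType) (a b X : R) : {poly R} :=
  'X^4 - (2 * a)%:P * 'X^2 - (8 * b)%:P * 'X + (a ^+ 2)%:P
  - (4 * X)%:P * weierstrass_poly a b.

Lemma horner_weierstrass (R : comNzRingType) (a b x : R) :
  (weierstrass_poly a b).[x] = x ^+ 3 + a * x + b.
Proof. by rewrite /weierstrass_poly !hornerE. Qed.

Lemma horner_halving (R : comNzRingType) (a b X x : R) :
  (halving_poly a b X).[x] =
  x ^+ 4 - 2 * a * x ^+ 2 - 8 * b * x + a ^+ 2 - 4 * X * (x ^+ 3 + a * x + b).
Proof. by rewrite /halving_poly /weierstrass_poly !hornerE. Qed.

Lemma monic_coef (R : nzRingType) (p : {poly R}) n :
  p`_n = 1 -> (forall j, (n < j)%N -> p`_j = 0) -> p \is monic.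
Proof.
move=> pn pj; have sp : size p = n.+1.
  apply/eqP; rewrite eqn_leq; apply/andP; split; first exact/leq_sizeP.
  apply: contraT; rewrite -leqNgt => /leq_sizeP/(_ n (leqnn n))/eqP.
  by rewrite pn oner_eq0.
by rewrite monicE lead_coefE sp pn.
Qed.

Lemma weierstrass_monic (R : comNzRingType) (a b : R) :
  weierstrass_poly a b \is monic.
Proof.
apply: (@monic_coef _ _ 3) => [|[|[|[|[|j]]]]] //; rewrite /weierstrass_poly.
  by rewrite !coefE !(mulr0, addr0).
by rewrite !coefE /= !(mulr0, addr0).
Qed.

Lemma halving_monic (R : comNzRingType) (a b X : R) :
  halving_poly a b X \is monic.
Proof.
apply: (@monic_coef _ _ 4) => [|[|[|[|[|[|j]]]]]] //;
  rewrite /halving_poly /weierstrass_poly.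
  by rewrite !coefE /= !(mulr0, addr0, subr0).
by rewrite !coefE /= !(mulr0, addr0, subr0).
Qed.

Lemma map_weierstrass (R : comNzRingType) (a b : int) :
  map_poly intr (weierstrass_poly a b) = weierstrass_poly a%:~R b%:~R :> {poly R}.
Proof.
by rewrite /weierstrass_poly !(rmorphD, rmorphM) /= !map_polyC map_polyX ?map_polyXn.
Qed.

Lemma map_halving (R : comNzRingType) (a b X : int) :
  map_poly intr (halving_poly a b X) = halving_poly a%:~R b%:~R X%:~R :> {poly R}.
Proof.
rewrite /halving_poly rmorphB [X in _ - X]rmorphM /= map_weierstrass.
rewrite !(rmorphD, rmorphN, rmorphM) /=.
by rewrite !map_polyC map_polyX ?map_polyXn.
Qed.

(** * The group law *)

Section GroupLaw.
Variables (F : fieldType) (a b : F).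
Implicit Types (P Q R S T : F * F) (h : {poly F}) (k l m : F).

Local Notation f := (weierstrass_poly a b).

Definition opp_pt P : F * F := (P.1, - P.2).

Definition line l m : {poly F} := l%:P * 'X + m%:P.

Lemma horner_line l m x : (line l m).[x] = l * x + m.
Proof. by rewrite !hornerE. Qed.

(** The three points are the whole intersection of the curve with the line
    y = l x + m, counted with multiplicity.  A vertical line is not of this
    form. *)
Definition meets_at l m P Q T : Prop :=
  f - line l m ^+ 2 = ('X - P.1%:P) * ('X - Q.1%:P) * ('X - T.1%:P) /\
  [/\ P.2 = l * P.1 + m, Q.2 = l * Q.1 + m & T.2 = l * T.1 + m].

Lemma opp_ptK P : opp_pt (opp_pt P) = P.
Proof. by case: P => x y; rewrite /opp_pt /= opprK. Qed.

Lemma meets_atC l m P Q T : meets_at l m P Q T -> meets_at l m Q P T.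
Proof. by case=> e [? ? ?]; split=> //; rewrite e [in RHS](mulrC ('X - _)). Qed.

Lemma meets_at_rot l m P Q T : meets_at l m P Q T -> meets_at l m T P Q.
Proof. by case=> e [? ? ?]; split=> //; rewrite e; ring. Qed.

Lemma meets_at_opp l m P Q T :
  meets_at l m P Q T -> meets_at (- l) (- m) (opp_pt P) (opp_pt Q) (opp_pt T).
Proof.
case=> e [eP eQ eT]; split; last by split; rewrite /= ?eP ?eQ ?eT; ring.
rewrite /= -e /line; ring.
Qed.

(** The coefficients a and b are determined by two points and the slope, so
    that the factorization becomes an identity between polynomials in the
    coordinates and the slope. *)
Lemma slope_meets P Q l (x3 := l ^+ 2 - P.1 - Q.1) :
    on_curve a b (Some P) -> on_curve a b (Some Q) ->
    ~~ ((P.1 == Q.1) && (P.2 == - Q.2)) -> l = slope a P.1 P.2 Q.1 Q.2 ->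
  meets_at l (P.2 - l * P.1) P Q (x3, P.2 - l * (P.1 - x3)).
Proof.
case: P Q @x3 => [x1 y1] [x2 y2] /= /eqP e1 /eqP e2 nPQ el.
have [hl ha] : y2 = y1 + l * (x2 - x1) /\
    a = l * (y1 + y2) - (x1 ^+ 2 + x1 * x2 + x2 ^+ 2).
  move: nPQ e2 el; rewrite /slope; case: eqVneq => [<-|ne] /= nPQ e2 el.
    have yy : y1 = y2.
      have /eqP : (y1 - y2) * (y1 + y2) = 0 by rewrite -subr_sqr e1 e2 subrr.
      by rewrite mulf_eq0 subr_eq0 addr_eq0 (negPf nPQ) orbF => /eqP.
    subst y2; have y2n0 : 2 * y1 != 0.
      by rewrite mulr_natl mulr2n addr_eq0.
    have : l * (2 * y1) = 3 * x1 ^+ 2 + a by rewrite el divfK.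
    by move=> hl; split; [ring | rewrite -mulr2n -mulr_natl hl; ring].
  have dn0 : x2 - x1 != 0 by rewrite subr_eq0 eq_sym.
  have hl : y2 = y1 + l * (x2 - x1) by rewrite el divfK //; ring.
  split=> //; apply: (mulIf dn0).
  have -> : a * (x2 - x1) = (x2 ^+ 3 + a * x2 + b) - (x1 ^+ 3 + a * x1 + b)
                           - (x2 ^+ 3 - x1 ^+ 3) by ring.
  by rewrite -e1 -e2 hl; ring.
have hb : b = y1 ^+ 2 - x1 ^+ 3 - a * x1 by rewrite e1; ring.
split=> /=; last by split; rewrite ?hl; ring.
rewrite /weierstrass_poly /line hb ha hl.
rewrite !(polyCD, polyCB, polyCM, polyCN, polyC_exp); ring.
Qed.

Lemma add_meets P Q S :
    on_curve a b (Some P) -> on_curve a b (Some Q) ->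
    add_raw a (Some P) (Some Q) = Some S ->
  exists l m, meets_at l m P Q (opp_pt S).
Proof.
move=> oP oQ; have := @slope_meets P Q _ oP oQ.
case: P Q oP oQ => [x1 y1] [x2 y2] oP oQ /=; case: ifP => // _ /(_ _ isT erefl).
move=> H [<-]; rewrite /opp_pt /= opprB.
by eexists; eexists; exact: H.
Qed.

(** From here on the curve has no point of order 2: ordinates do not vanish. *)
Hypotheses (two_neq0 : (2 : F) != 0) (no_root : forall x, ~~ root f x).

Lemma on_curveE P : on_curve a b (Some P) = (P.2 ^+ 2 == f.[P.1]).
Proof. by case: P => x y /=; rewrite horner_weierstrass. Qed.

Lemma ord_neq0 P : on_curve a b (Some P) -> P.2 != 0.
Proof.
rewrite on_curveE; apply: contraTneq => ->.
by rewrite expr0n /= eq_sym; exact: no_root.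
Qed.

Lemma ord_neq_opp P : on_curve a b (Some P) -> P.2 != - P.2.
Proof.
move=> /ord_neq0; apply: contra => /eqP e.
suff /eqP : 2 * P.2 = 0 by rewrite mulf_eq0 (negPf two_neq0).
by rewrite mulr_natl mulr2n {1}e addNr.
Qed.

(** Conversely, intersecting with a line computes a sum.  For P = Q, the slope
    of the line is the tangent slope because P is a double root of the
    intersection polynomial. *)
Lemma meets_add l m P Q T : on_curve a b (Some P) -> on_curve a b (Some Q) ->
  meets_at l m P Q T -> add_raw a (Some P) (Some Q) = Some (opp_pt T).
Proof.
move=> oP oQ [e [eP eQ eT]].
have nPQ : ~~ ((P.1 == Q.1) && (P.2 == - Q.2)).
  apply/negP => /andP[/eqP ex /eqP ey]; have := ord_neq_opp oP.
  by rewrite {2}eP ex -eQ ey eqxx.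
have el : l = slope a P.1 P.2 Q.1 Q.2.
  rewrite /slope; case: (eqVneq P.1 Q.1) => [ex|nx].
    (* G is the quotient of the intersection polynomial by X - P.1, and its
       second root P.1 expresses the tangency. *)
    set G : {poly F} := 'X ^+ 2 + P.1%:P * 'X + (P.1 ^+ 2)%:P + a%:P
                          - l%:P * (line l m + (P.2)%:P).
    have eG : G = ('X - P.1%:P) * ('X - T.1%:P).
      have nz : 'X - P.1%:P != 0 :> {poly F} by rewrite polyXsubC_eq0.
      apply: (mulfI nz).
      rewrite mulrA {3}ex -e.
      transitivity (f - line l m ^+ 2 - (f - line l m ^+ 2).[P.1]%:P).
        rewrite /G hornerD hornerN horner_exp horner_line horner_weierstrass eP.
        rewrite /weierstrass_poly /line.
        by rewrite !(polyCD, polyCB, polyCM, polyCN, polyC_exp); ring.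
      by rewrite e !hornerM hornerXsubC subrr !mul0r subr0.
    have e' : P.1 ^+ 2 + P.1 * P.1 + P.1 ^+ 2 + a - l * (P.2 + P.2) = 0.
      have := congr1 (horner^~ P.1) eG.
      by rewrite /G /line !hornerE -eP subrr mul0r.
    have -> : 3 * P.1 ^+ 2 + a = l * (2 * P.2).
      by apply/eqP; rewrite -subr_eq0 -e'; apply/eqP; ring.
    by rewrite mulfK // mulf_neq0 ?(ord_neq0 oP).
  have dn0 : Q.1 - P.1 != 0 by rewrite subr_eq0 eq_sym.
  by apply: (mulIf dn0); rewrite divfK // eP eQ; ring.
have [e2 _] := slope_meets oP oQ nPQ el.
have em : P.2 - l * P.1 = m by rewrite eP; ring.
have nz : ('X - P.1%:P) * ('X - Q.1%:P) != 0 :> {poly F}.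
  by rewrite mulf_neq0 ?polyXsubC_eq0.
move: e2; rewrite em e => /(mulfI nz)/addrI/oppr_inj/polyC_inj /= ex.
rewrite /opp_pt eT ex; move: nPQ el eP; case: (P) (Q) => x1 y1 [x2 y2] /=.
by move=> /negPf -> <- ->; congr (Some (_, _)); ring.
Qed.

Local Notation add := (add_raw a).
Local Notation on := (on_curve a b).

Lemma on_curve_opp P : on (Some (opp_pt P)) = on (Some P).
Proof. by rewrite !on_curveE /= sqrrN. Qed.

Lemma add_raw_None P Q : add (Some P) (Some Q) = None -> Q = opp_pt P.
Proof.
case: P Q => [x1 y1] [x2 y2] /=; case: ifP => // /andP[/eqP -> /eqP ->] _.
by rewrite /opp_pt /= opprK.
Qed.

Lemma add_raw_opp P : add (Some P) (Some (opp_pt P)) = None.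
Proof. by case: P => x y /=; rewrite opprK !eqxx. Qed.

Lemma add_raw_oppl P : add (Some (opp_pt P)) (Some P) = None.
Proof. by rewrite -{2}(opp_ptK P) add_raw_opp. Qed.

Lemma add_raw0 p : add p None = p.
Proof. by case: p => [[]|]. Qed.

Lemma add_rawC p q : on p -> on q -> add p q = add q p.
Proof.
case: p q => [P|] [Q|] oP oQ; rewrite ?add_raw0 //.
case E : (add (Some P) (Some Q)) => [S|].
  have [l [m /meets_atC/(meets_add oQ oP) ->]] := add_meets oP oQ E.
  by rewrite opp_ptK.
by rewrite (add_raw_None E) add_raw_oppl.
Qed.

(** If P, Q and -S are collinear, then Q - S = -P. *)
Lemma add_raw_rot P Q S : on (Some P) -> on (Some Q) ->
  add (Some P) (Some Q) = Some S ->
  add (Some Q) (Some (opp_pt S)) = Some (opp_pt P).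
Proof.
move=> oP oQ E; have [l [m M]] := add_meets oP oQ E.
have oS : on (Some (opp_pt S)) by rewrite on_curve_opp -E; exact: on_curve_add.
exact: meets_add oQ oS (meets_at_rot (meets_at_rot M)).
Qed.

(** If P, Q and -S are collinear, then so are S, -Q and -P. *)
Lemma add_rawK p Q : on p -> on (Some Q) ->
  add (add p (Some Q)) (Some (opp_pt Q)) = p.
Proof.
case: p => [P|] oP oQ; last by rewrite add_raw_opp.
case E : (add (Some P) (Some Q)) => [S|]; last by rewrite (add_raw_None E) opp_ptK.
have [l [m M]] := add_meets oP oQ E.
have oS : on (Some S) by rewrite -E; exact: on_curve_add.
have := meets_at_opp (meets_at_rot (meets_atC M)); rewrite opp_ptK.
by move/meets_add ->; rewrite ?opp_ptK // on_curve_opp.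
Qed.

(** The curve k y = h(x) passes through the four points, and h^2 - k^2 f, the
    norm of h - k y from the function field to F(x), accounts for them with
    multiplicity. *)
Definition interpolates h k P Q R T : Prop :=
  [/\ h \is monic /\ size h = 3%N, k != 0,
      [/\ h.[P.1] = k * P.2, h.[Q.1] = k * Q.2, h.[R.1] = k * R.2 & h.[T.1] = k * T.2]
    & h ^+ 2 - k%:P ^+ 2 * f =
      ('X - P.1%:P) * ('X - Q.1%:P) * ('X - R.1%:P) * ('X - T.1%:P)].

Lemma monic_quadratic (u v c d : F) :
  let h := ('X - u%:P) * ('X - v%:P) + (c%:P * 'X + d%:P) in
  h \is monic /\ size h = 3%N.
Proof.
set p := ('X - _) * _; set q := _ * 'X + _ => /=.
have sp : size p = 3%N by rewrite size_monicM ?monicXsubC ?polyXsubC_eq0 // !size_XsubC.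
have sq : (size q < 3)%N.
  by rewrite /q size_MXaddC; case: ifP => // _; rewrite !ltnS size_polyC_leq1.
rewrite size_polyDl sp //; split=> //.
by rewrite monicE lead_coefDl ?sp // -monicE monicMl monicXsubC.
Qed.

(** If L1 is the line through P, Q, -S0 and L2 the line through S0, R, -S, then
    L1 L2 has the right zeros together with S0 and -S0; dividing it by X - S0.1
    leaves the function h - k y, where k is the sum of the two slopes.  It
    vanishes exactly when L2 is the mirror image of L1, which makes R opposite
    to P or Q. *)
Lemma add_interpolates P Q R S0 S :
    on (Some P) -> on (Some Q) -> on (Some R) -> R != opp_pt P -> R != opp_pt Q ->
    add (Some P) (Some Q) = Some S0 -> add (Some S0) (Some R) = Some S ->
  exists h k, interpolates h k P Q R (opp_pt S).
Proof.
move=> oP oQ oR nRP nRQ E0 E.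
have oS0 : on (Some S0) by rewrite -E0; exact: on_curve_add.
have [l1 [m1 [e1 [eP eQ eS0']]]] := add_meets oP oQ E0.
have [l2 [m2 [e2 [eS0 eR eS]]]] := add_meets oS0 oR E.
pose k := l1 + l2.
have eL : line l1 m1 + line l2 m2 = k%:P * ('X - S0.1%:P).
  have : m1 + m2 = - (k * S0.1).
    have -> : m1 = - S0.2 - l1 * S0.1 by rewrite -[- S0.2]/(opp_pt S0).2 eS0'; ring.
    have -> : m2 = S0.2 - l2 * S0.1 by rewrite eS0; ring.
    by rewrite /k; ring.
  move=> em; transitivity ((l1%:P + l2%:P) * 'X + (m1 + m2)%:P).
    by rewrite polyCD /line; ring.
  by rewrite em polyCN polyCM -polyCD -/k; ring.
have nz : 'X - S0.1%:P != 0 :> {poly F} by rewrite polyXsubC_eq0.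
have k0 : k != 0.
  apply/eqP => k0; move/eqP: eL; rewrite k0 mul0r addr_eq0 => /eqP eL.
  have eRL : R.2 = - (l1 * R.1 + m1) by rewrite -horner_line eL hornerN opprK horner_line.
  have : ('X - P.1%:P) * ('X - Q.1%:P) = ('X - R.1%:P) * ('X - S.1%:P).
    by apply: (mulIf nz); rewrite -[S0.1]/(opp_pt S0).1 -e1 eL sqrrN e2 /=; ring.
  move/(congr1 (horner^~ R.1))/esym/eqP.
  rewrite !hornerM !hornerXsubC subrr mul0r eq_sym mulf_eq0 !subr_eq0.
  case/orP => /eqP eRx; [move: nRP | move: nRQ]; rewrite /opp_pt ?eP ?eQ -eRx -eRL.
    by case: (R) => ? ? /=; rewrite eqxx.
  by case: (R) => ? ? /=; rewrite eqxx.
(* The quotient of f + L1 L2 by X - S0.1 has two expressions, one for each line;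
   the first one shows its values at P and Q, the second one at R and S. *)
set h := ('X - P.1%:P) * ('X - Q.1%:P) + k%:P * line l1 m1.
have hE : h * ('X - S0.1%:P) = f + line l1 m1 * line l2 m2.
  transitivity (f - line l1 m1 ^+ 2 + (line l1 m1 + line l2 m2) * line l1 m1);
    last ring.
  by rewrite e1 eL /h; ring.
have eh : h = ('X - R.1%:P) * ('X - (opp_pt S).1%:P) + k%:P * line l2 m2.
  apply: (mulIf nz); rewrite hE.
  transitivity (f - line l2 m2 ^+ 2 + (line l1 m1 + line l2 m2) * line l2 m2);
    first ring.
  by rewrite e2 eL; ring.
exists h, k; split=> //.
- rewrite /h; have -> : k%:P * line l1 m1 = (k * l1)%:P * 'X + (k * m1)%:P.
    by rewrite /line !polyCM; ring.
  exact: monic_quadratic.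
- split; rewrite ?eP ?eQ ?eR ?eS -horner_line.
  + by rewrite /h hornerD !hornerM !hornerXsubC subrr mul0r add0r hornerC.
  + by rewrite /h hornerD !hornerM !hornerXsubC subrr mulr0 add0r hornerC.
  + by rewrite eh hornerD !hornerM !hornerXsubC subrr mul0r add0r hornerC.
  + by rewrite eh hornerD !hornerM !hornerXsubC subrr mulr0 add0r hornerC.
apply: (mulIf (expf_neq0 2 nz)).
transitivity ((f - line l1 m1 ^+ 2) * (f - line l2 m2 ^+ 2)).
  rewrite mulrBl -exprMn hE mulrAC -exprMn -eL; ring.
by rewrite e1 e2 /=; ring.
Qed.

(** Modulo M = (X-xP)(X-xQ)(X-xR), both (k' h)^2 and (k h')^2 are equal to
    (k k')^2 f, hence M divides (k' h - k h')(k' h + k h').  The second factor is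
    2 k k' y at each of the three points, hence is prime to M, and the first one
    has degree at most 2, hence vanishes.  Both curves being equal, so are
    their fourth points. *)
Lemma interpolates_uniq h h' k k' P Q R S S' :
  on (Some P) -> on (Some Q) -> on (Some R) ->
  interpolates h k P Q R S -> interpolates h' k' P Q R S' -> S = S'.
Proof.
move=> oP oQ oR [[mh sh] k0 [hP hQ hR hS] eh] [[mh' sh'] k0' [hP' hQ' hR' hS'] eh'].
pose M := ('X - P.1%:P) * ('X - Q.1%:P) * ('X - R.1%:P).
have sM : size M = 4%N.
  by rewrite /M !size_monicM ?monicMl ?monicXsubC ?mulf_neq0 ?polyXsubC_eq0 ?size_XsubC.
have cM : coprimep M (k'%:P * h + k%:P * h').
  have nr T : on (Some T) -> h.[T.1] = k * T.2 -> h'.[T.1] = k' * T.2 ->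
      coprimep ('X - T.1%:P) (k'%:P * h + k%:P * h').
    move=> oT hT hT'; rewrite coprimep_sym coprimep_XsubC rootE !hornerE hT hT'.
    have -> : k' * (k * T.2) + k * (k' * T.2) = 2 * k * k' * T.2 by ring.
    by rewrite !mulf_neq0 ?ord_neq0.
  by rewrite !coprimepMl !nr.
have dM : M %| k'%:P * h - k%:P * h'.
  rewrite -(Gauss_dvdpl _ cM) -subr_sqr; apply/dvdpP.
  exists (k'%:P ^+ 2 * ('X - S.1%:P) - k%:P ^+ 2 * ('X - S'.1%:P)).
  transitivity (k'%:P ^+ 2 * (h ^+ 2 - k%:P ^+ 2 * f)
                - k%:P ^+ 2 * (h' ^+ 2 - k'%:P ^+ 2 * f)); first ring.
  by rewrite eh eh' /M; ring.
have e0 : k'%:P * h - k%:P * h' = 0.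
  apply/eqP; apply: contraTT dM => nz; apply/negP => /(dvdp_leq nz).
  rewrite sM leqNgt ltnS (leq_trans (size_polyD _ _)) // size_polyN geq_max.
  by rewrite !mul_polyC !(leq_trans (size_scale_leq _ _)) ?sh ?sh'.
have ek : k' = k.
  have /(congr1 lead_coef) : k'%:P * h = k%:P * h' by apply/eqP; rewrite -subr_eq0 e0.
  by rewrite !lead_coefM !lead_coefC (monicP mh) (monicP mh') !mulr1.
move/eqP: e0; rewrite ek -mulrBr mulf_eq0 polyC_eq0 (negPf k0) subr_eq0 => /eqP ehh.
move: eh'; rewrite -ehh ek eh => /mulfI; rewrite -/M -size_poly_eq0 sM => /(_ isT).
move/addrI/oppr_inj/polyC_inj => ex.
have /(mulfI k0) ey : k * S.2 = k * S'.2 by rewrite -hS ex ehh hS' ek.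
by move: ex ey; case: (S) (S') => x1 y1 [x2 y2] /= -> ->.
Qed.

Lemma interpolates_rot h k P Q R T :
  interpolates h k P Q R T -> interpolates h k R P Q T.
Proof. by case=> ? ? [? ? ? ?] e; split=> //; rewrite e; ring. Qed.

(** When two of the points are opposite, or one of the sums is the point at
    infinity, cancellation suffices; otherwise both sides are the opposite of
    the fourth point of the curve through P, Q and R. *)
Lemma add_rawA p q r :
  on p -> on q -> on r -> add p (add q r) = add (add p q) r.
Proof.
case: p q r => [P|] [Q|] [R|] oP oQ oR; rewrite ?add_raw0 //.
have oN T : on (Some T) -> on (Some (opp_pt T)) by rewrite on_curve_opp.
case: (eqVneq Q (opp_pt P)) => [eQ|nPQ].
  rewrite add_rawC //; last exact: on_curve_add.
  rewrite (add_rawC oQ oR) eQ -{2}(opp_ptK P) add_rawK ?add_raw_opp //; exact: oN.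
case: (eqVneq R (opp_pt Q)) => [->|nQR].
  by rewrite add_rawK // add_raw_opp add_raw0.
case: (eqVneq R (opp_pt P)) => [->|nRP].
  rewrite (add_rawC oP oQ) add_rawK // add_rawC //; last exact/on_curve_add/oN.
  by rewrite -{2}(opp_ptK P) add_rawK //; exact: oN.
case E0 : (add (Some P) (Some Q)) => [S0|]; last first.
  by rewrite (add_raw_None E0) eqxx in nPQ.
case E1 : (add (Some Q) (Some R)) => [S1|]; last first.
  by rewrite (add_raw_None E1) eqxx in nQR.
have oS0 : on (Some S0) by rewrite -E0; exact: on_curve_add.
have oS1 : on (Some S1) by rewrite -E1; exact: on_curve_add.
case E : (add (Some S0) (Some R)) => [S|]; last first.
  move: E1; rewrite (add_raw_None E) (add_raw_rot oP oQ E0) => -[<-].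
  exact: add_raw_opp.
case E' : (add (Some P) (Some S1)) => [S'|]; last first.
  move: E1 E; rewrite add_rawC // (add_raw_None E') => /(add_raw_rot oR oQ).
  by rewrite opp_ptK add_rawC // E0 => -[->]; rewrite add_raw_oppl.
have [h [k H]] := add_interpolates oP oQ oR nRP nQR E0 E.
have nPR : P != opp_pt R by apply: contra nRP => /eqP ->; rewrite opp_ptK.
have nPQ' : P != opp_pt Q by apply: contra nPQ => /eqP ->; rewrite opp_ptK.
rewrite add_rawC // in E'.
have [h' [k' /interpolates_rot H']] := add_interpolates oQ oR oP nPQ' nPR E1 E'.
have := interpolates_uniq oP oQ oR H H'.
by move/(congr1 opp_pt); rewrite !opp_ptK => ->.
Qed.

End GroupLaw.

Lemma ec_eq (F : fieldType) (a b : F) (P Q : ecpoint a b) :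
  sval P = sval Q -> P = Q.
Proof. exact: val_inj. Qed.

(** The points of the curve, with the absence of points of order 2 recorded in
    the type so that the group structure can be inferred from it. *)
Definition ec_group (F : fieldType) (a b : F) (_ : (2 : F) != 0)
  (_ : forall x, ~~ root (weierstrass_poly a b) x) : Type := ecpoint a b.

Section GroupInstance.
Variables (F : fieldType) (a b : F) (two_neq0 : (2 : F) != 0).
Hypothesis no_root : forall x, ~~ root (weierstrass_poly a b) x.
Local Notation E := (ec_group two_neq0 no_root).

HB.instance Definition _ := Choice.copy E {P | on_curve a b P}.

Definition ec_opp (P : E) : E :=
  match P with
  | exist None _ => ec_zero a b
  | exist (Some Q) oQ =>
      exist (on_curve a b) _ (etrans (on_curve_opp a b Q) oQ)
  end.

Lemma ec_addA : associative (@ec_add F a b : E -> E -> E).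
Proof.
move=> P Q R; apply: ec_eq.
exact: (add_rawA two_neq0 no_root (svalP P) (svalP Q) (svalP R)).
Qed.

Lemma ec_addC : commutative (@ec_add F a b : E -> E -> E).
Proof.
move=> P Q; apply: ec_eq.
exact: (add_rawC two_neq0 no_root (svalP P) (svalP Q)).
Qed.

Lemma ec_add0 : left_id (ec_zero a b) (@ec_add F a b : E -> E -> E).
Proof. by move=> P; apply: ec_eq. Qed.

Lemma ec_addN : left_inverse (ec_zero a b) ec_opp (@ec_add F a b : E -> E -> E).
Proof. by move=> [[P|] oP]; apply: ec_eq => //; exact: add_raw_oppl. Qed.

HB.instance Definition _ :=
  GRing.isZmodule.Build E ec_addA ec_addC ec_add0 ec_addN.

Lemma ec_addE (P Q : E) : P + Q = ec_add P Q. Proof. by []. Qed.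

Lemma ec_double_eq0 (P : E) : P *+ 2 = 0 -> P = 0.
Proof.
case: P => [[P|] oP] e; apply: ec_eq => //=.
have /(congr1 sval)/= /add_raw_None /(congr1 snd) /= := e.
by move/eqP; rewrite (negPf (ord_neq_opp two_neq0 no_root oP)).
Qed.

(** The duplication formula, with the ordinate eliminated. *)
Lemma ec_double_root (P : E) X Y :
  sval (P *+ 2) = Some (X, Y) -> exists x, root (halving_poly a b X) x.
Proof.
case: P => [[[x y]|] oP] //; rewrite mulr2n ec_addE /= /slope !eqxx /=.
have y0 : y != 0 := ord_neq0 no_root oP.
rewrite (negPf (ord_neq_opp two_neq0 no_root oP)) => -[eX _]; exists x.
have /eqP ey := oP.
set l := _ / _ in eX.
have hl : l * (2 * y) = 3 * x ^+ 2 + a by rewrite /l divfK // mulf_neq0.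
have e : (3 * x ^+ 2 + a) ^+ 2 = 4 * (x ^+ 3 + a * x + b) * (X + 2 * x).
  by rewrite -hl -ey -eX; ring.
rewrite rootE horner_halving; apply/eqP.
by move/eqP: e; rewrite -subr_eq0 => /eqP <-; ring.
Qed.

Lemma ec_add_chord (P Q : E) l x1 y1 x2 y2 :
    sval P = Some (x1, y1) -> sval Q = Some (x2, y2) ->
    x1 != x2 -> y2 - y1 = l * (x2 - x1) ->
  sval (P + Q) =
    Some (l ^+ 2 - x1 - x2, l * (x1 - (l ^+ 2 - x1 - x2)) - y1).
Proof.
move=> eP eQ nx el; have dn0 : x2 - x1 != 0 by rewrite subr_eq0 eq_sym.
rewrite ec_addE -[LHS]/(add_raw a (sval P) (sval Q)) eP eQ /=.
by rewrite /slope (negPf nx) /= el mulfK.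
Qed.

End GroupInstance.

(** * Rank and independence *)

(** By the Smith normal form M = L D R of the matrix of phi, if r < n then the
    last row of L^-1 is a nonzero vector in the kernel. *)
Lemma additive_inj_leq n r (phi : 'rV[int]_n -> 'rV[int]_r) :
  {morph phi : u v / u + v} -> injective phi -> (n <= r)%N.
Proof.
move=> phiD phi_inj; rewrite leqNgt; apply/negP => rn.
have phiB : {morph phi : u v / u - v}.
  by move=> u v; apply: (addIr (phi v)); rewrite subrK -phiD subrK.
pose f : {additive 'rV[int]_n -> 'rV[int]_r} :=
  HB.pack phi (GRing.isZmodMorphism.Build _ _ phi phiB).
pose M : 'M[int]_(n, r) := \matrix_i phi (delta_mx 0 i).
have scaleE p c (v : 'rV[int]_p) : c *: v = v *~ c by rewrite -scaler_int intz.
have fE u : phi u = u *m M.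
  rewrite [u in LHS]row_sum_delta -[phi]/(f : _ -> _) raddf_sum mulmx_sum_row.
  by apply: eq_bigr => i _; rewrite !scaleE raddfMz rowK.
have [L uL [R uR [d _ eM]]] := int_Smith_normal_form M.
have n0 : (n.-1 < n)%N by rewrite ltn_predL (leq_ltn_trans _ rn).
pose u : 'rV_n := delta_mx 0 (Ordinal n0) *m invmx L.
have u0 : u = 0.
  apply: phi_inj; rewrite -[phi 0]/(f 0) raddf0 fE eM /u !mulmxA mulmxKV //.
  rewrite -rowE (_ : row _ _ = 0) ?mul0mx //.
  apply/rowP => j; rewrite !mxE /= gtn_eqF ?mulr0n //.
  by rewrite (leq_trans (ltn_ord j)) // -ltnS prednK // (leq_ltn_trans _ rn).
have /matrixP/(_ 0 (Ordinal n0)) : delta_mx 0 (Ordinal n0) = 0 :> 'rV[int]_n.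
  by rewrite -(mulmxKV uL (delta_mx _ _)) -/u u0 mul0mx.
by rewrite !mxE !eqxx.
Qed.

(** On an affine P the tangent construction returns P only if y = -y, and then
    the sum is the point at infinity instead. *)
Lemma ec_idem0 (F : fieldType) (a b : F) (P : ecpoint a b) :
  ec_add P P = P -> P = ec_zero a b.
Proof.
case: P => [[[x y]|] oP] e; apply: ec_eq => //=; move/(congr1 sval): e => /=.
rewrite eqxx /=; case: ifP => // y0 [e1 e2].
move: e2; rewrite e1 subrr mulr0 sub0r => ey.
by rewrite -{1}ey eqxx in y0.
Qed.

(** Two elements of Z^n with the same image in Z^r differ by some w whose image
    in E(Q) has the form (0, T) with T torsion, so that a multiple of w is 0. *)
Lemma has_rank_geq (a b : rat) n r (g : 'rV[int]_n -> ecpoint a b) :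
  injective g -> (forall u v, g (u + v) = ec_add (g u) (g v)) ->
  has_rank a b r -> (n <= r)%N.
Proof.
move=> g_inj gD [f [[ff f_inj _] fD]].
have g0 : g 0 = ec_zero a b by apply: ec_idem0; rewrite -gD addr0.
have f0 : f (ec_zero a b) = (0, ec_zero a b).
  have := fD (ec_zero a b) (ec_zero a b).
  rewrite (_ : ec_add _ _ = ec_zero a b); last exact: ec_eq.
  case: (f _) => x y /= [ex /esym/ec_idem0 ->]; congr (_, _).
  by apply: (addrI x); rewrite addr0 -ex.
pose phi u := (f (g u)).1.
have phiD : {morph phi : u v / u + v} by move=> u v; rewrite /phi gD fD.
apply: (additive_inj_leq phiD) => u v euv.
pose w := u - v.
have phiw : phi w = 0 by apply: (addIr (phi v)); rewrite -phiD subrK add0r.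
have [_ [k k_gt0 ek]] := ff (g w) I.
have fgwn m : f (g (w *+ m)) = (0, iter m (ec_add (f (g w)).2) (ec_zero a b)).
  elim: m => [|m IH]; first by rewrite mulr0n g0 f0.
  by rewrite mulrS gD fD IH /= addr0 -[(f (g w)).1]/(phi w) phiw.
have wk0 : w *+ k = 0.
  by apply/g_inj/f_inj; rewrite ?in_setE // fgwn ek g0 f0.
apply/eqP; rewrite -subr_eq0 -/w; apply/eqP/rowP => i; rewrite [RHS]mxE.
have /eqP : w 0 i *+ k = 0 by rewrite -mulmxnE wk0 mxE.
by rewrite mulrn_eq0 eqn0Ngt k_gt0 => /eqP.
Qed.

(** Infinite descent on the size of the coefficients: the odd coefficients of a
    relation form a subset whose sum is a double, so there are none and the
    relation can be halved. *)
Lemma indep_mod2 (V : zmodType) n (e : 'I_n -> V) :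
  (forall x : V, x *+ 2 = 0 -> x = 0) ->
  (forall S : {set 'I_n}, S != finset.set0 ->
     forall x : V, \sum_(i in S) e i <> x *+ 2) ->
  injective (fun u : 'rV[int]_n => \sum_i e i *~ u 0 i).
Proof.
move=> tf nS.
pose g (u : 'rV[int]_n) := \sum_i e i *~ u 0 i.
have gB (u v : 'rV_n) : g (u - v) = g u - g v.
  by rewrite /g -sumrB; apply: eq_bigr => i _; rewrite !mxE mulrzBr.
suff ker0 : forall m (u : 'rV[int]_n), (\sum_i `|u 0%R i| <= m)%N -> g u = 0 -> u = 0.
  move=> u v euv; apply/eqP; rewrite -subr_eq0; apply/eqP.
  by apply: ker0 (leqnn _) _; rewrite gB [g u]euv subrr.
elim=> [|m IH] u um gu0.
  apply/rowP => i; rewrite mxE; apply/eqP; rewrite -absz_eq0.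
  by move: um; rewrite leqn0 sum_nat_eq0 => /forallP/(_ i).
pose q : 'rV[int]_n := \row_i (u 0%R i %/ 2)%Z.
pose S : {set 'I_n} := [set i | (u 0%R i %% 2)%Z != 0]%SET.
have gE : g u = g q *+ 2 + \sum_(i in S) e i.
  rewrite /g -sumrMnl [X in _ + X]big_mkcond -big_split; apply: eq_bigr => i _ /=.
  rewrite inE {1}(divz_eq (u 0 i) 2) mulrzDr mxE mulrzA -pmulrn.
  congr (_ + _); have := ltz_pmod (u 0 i) (isT : 0 < 2 :> int).
  have := modz_ge0 (u 0 i) (isT : 2 != 0 :> int).
  by case: (u 0%R i %% 2)%Z => // -[|[|]].
have S0 : S = finset.set0.
  apply/eqP; apply: contraPT (gE) => /nS neq; rewrite gu0 => /esym/eqP.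
  by rewrite addrC addr_eq0 -mulNrn => /eqP/neq.
have uq : u = q *+ 2.
  apply/rowP => i; rewrite mulmxnE mxE.
  have : i \notin S by rewrite S0 inE.
  by rewrite inE negbK => /eqP ei; rewrite {1}(divz_eq (u 0 i) 2) ei addr0 mulr_natr.
suff q0 : q = 0 by rewrite uq q0 mul0rn.
apply: IH; last by apply: tf; rewrite -gu0 gE S0 big_set0 addr0.
have : (\sum_i `|u 0%R i| = (\sum_i `|q 0%R i|).*2)%N.
  rewrite -mul2n big_distrr; apply: eq_bigr => i _.
  by rewrite uq mulmxnE -mulr_natl abszM.
lia.
Qed.

Lemma rank_ge_of_indep (a b : rat) n (two_neq0 : (2 : rat) != 0)
    (nr : forall x, ~~ root (weierstrass_poly a b) x)
    (e : 'I_n -> ec_group two_neq0 nr) :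
  (forall S : {set 'I_n}, S != finset.set0 ->
     forall x, \sum_(i in S) e i <> x *+ 2) ->
  rank_ge a b n.
Proof.
move=> nS; pose g (u : 'rV[int]_n) : ec_group two_neq0 nr := \sum_i e i *~ u 0 i.
have gi : injective g := indep_mod2 (@ec_double_eq0 _ _ _ _ _) nS.
have gD u v : g (u + v) = ec_add (g u) (g v).
  by rewrite -ec_addE /g -big_split; apply: eq_bigr => i _; rewrite mxE mulrzDr.
by split; [move=> r; apply: has_rank_geq gi gD | exists g].
Qed.

(** A singular cubic has a rational multiple root, namely 3b/a, or 0 when
    a = 0. *)
Lemma no_root_elliptic (a b : rat) :
  (forall x, ~~ root (weierstrass_poly a b) x) -> elliptic a b.
Proof.
move=> nr; apply/negP => /eqP; rewrite /discriminant => e.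
have {}e : 4 * a ^+ 3 + 27 * b ^+ 2 = 0 by lra.
case: (eqVneq a 0) => [a0|a0].
  have b0 : b = 0.
    have /eqP : b ^+ 2 = 0 by move: e; rewrite a0; lra.
    by rewrite expf_eq0 => /eqP.
  by have := nr 0; rewrite rootE horner_weierstrass a0 b0 expr0n mul0r !addr0 eqxx.
have := nr (3 * b / a); rewrite rootE horner_weierstrass.
have -> : (3 * b / a) ^+ 3 + a * (3 * b / a) + b =
    b / a ^+ 3 * (4 * a ^+ 3 + 27 * b ^+ 2) by field.
by rewrite e mulr0 eqxx.
Qed.

(** * The family of curves *)

Definition conic_t (s : rat) : rat := (s ^+ 2 - 2) / (2 * s).

Definition conic_w (s : rat) : rat := (s ^+ 2 + 2) / (2 * s).

(** The abscissas of P1, P2, P1 + P2, P3, P1 + P3, P2 + P3, P1 + P2 + P3. *)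
Definition sum_abscissas (t w : rat) : seq rat :=
  [:: 0; t ^+ 2 - 1; 1 - t ^+ 2; - 1; t ^+ 2 * (2 - w) ^+ 2 + 1;
      (2 - w) ^+ 2 / t ^+ 2 + 2 - t ^+ 2; t ^+ 2 / (w - 2) ^+ 2 + t ^+ 2].

Section ThreePoints.
Variables t w : rat.
Local Notation a := (- (t ^+ 2 - 1) ^+ 2).
Local Notation b := ((2 * t) ^+ 2).
Hypotheses (t_gt2 : 2 < t) (w_neq2 : w - 2 != 0) (w2 : w ^+ 2 = t ^+ 2 + 2).
Hypothesis no_root : forall x, ~~ root (weierstrass_poly a b) x.
Hypothesis no_half : forall X, X \in sum_abscissas t w ->
  forall x, ~~ root (halving_poly a b X) x.

Let two_neq0 : (2 : rat) != 0. Proof. by []. Qed.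
Local Notation E := (ec_group two_neq0 no_root).

Fact on_curve1 : on_curve a b (Some (0, 2 * t)).
Proof. by apply/eqP; ring. Qed.

Fact on_curve2 : on_curve a b (Some (t ^+ 2 - 1, 2 * t)).
Proof. by apply/eqP; ring. Qed.

Fact on_curve3 : on_curve a b (Some (- 1, t * w)).
Proof. by apply/eqP; rewrite exprMn w2; ring. Qed.

Let P1 : E := exist (on_curve a b) _ on_curve1.
Let P2 : E := exist (on_curve a b) _ on_curve2.
Let P3 : E := exist (on_curve a b) _ on_curve3.

Let not_double (P : E) X Y : sval P = Some (X, Y) ->
  X \in sum_abscissas t w -> forall Q : E, P <> Q *+ 2.
Proof.
move=> eP /no_half nr Q eQ; rewrite eQ in eP.
by have [x] := ec_double_root eP; rewrite (negPf (nr x)).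
Qed.

Let t2_gt4 : 4 < t ^+ 2. Proof. by move: t_gt2; nra. Qed.

Let sum12 : sval (P1 + P2) = Some (1 - t ^+ 2, - (2 * t)).
Proof.
rewrite (@ec_add_chord _ _ _ _ _ P1 P2 0 0 (2 * t) (t ^+ 2 - 1) (2 * t)) //.
- by congr (Some (_, _)); ring.
- by rewrite lt_eqF //; move: t2_gt4; lra.
- by ring.
Qed.

Let sum13 : exists Y, sval (P1 + P3) = Some (t ^+ 2 * (2 - w) ^+ 2 + 1, Y).
Proof.
eexists; rewrite (@ec_add_chord _ _ _ _ _ P1 P3 (t * (2 - w))
                        0 (2 * t) (- 1) (t * w)) //.
- by congr (Some (_, _)); ring.
- by ring.
Qed.

Let sum23 :
  exists Y, sval (P2 + P3) = Some ((2 - w) ^+ 2 / t ^+ 2 + 2 - t ^+ 2, Y).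
Proof.
have t0 : t != 0 by rewrite gt_eqF //; move: t_gt2; lra.
eexists; rewrite (@ec_add_chord _ _ _ _ _ P2 P3 ((2 - w) / t)
                        (t ^+ 2 - 1) (2 * t) (- 1) (t * w)) //.
- by congr (Some (_, _)); field.
- by rewrite gt_eqF //; move: t2_gt4; lra.
- by field.
Qed.

Let sum123 :
  exists Y, sval (P1 + P2 + P3) = Some (t ^+ 2 / (w - 2) ^+ 2 + t ^+ 2, Y).
Proof.
eexists; rewrite (@ec_add_chord _ _ _ _ _ _ P3 (t / (w - 2))
                        _ _ (- 1) (t * w) sum12) //.
- by congr (Some (_, _)); field.
- by rewrite lt_eqF //; move: t2_gt4; lra.
- have -> : - 1 - (1 - t ^+ 2) = (w - 2) * (w + 2).
    by rewrite -subr_sqr w2; ring.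
  by field.
Qed.

Lemma three_points_rank : rank_ge a b 3.
Proof.
pose e (i : 'I_3) : E := nth 0 [:: P1; P2; P3] i.
apply: (@rank_ge_of_indep _ _ _ two_neq0 no_root e) => S S0 x.
rewrite big_mkcond !big_ord_recl big_ord0 /e /= addr0.
have : [|| ord0 \in S, lift ord0 ord0 \in S
         | lift ord0 (lift ord0 ord0) \in S].
  apply: contraNT S0; rewrite !negb_or => /and3P[n0 n1 n2].
  apply/eqP/setP => i; rewrite inE; apply/negbTE.
  case: i => [[|[|[|//]]] lt_i].
  - by rewrite (_ : Ordinal _ = ord0) //; exact: val_inj.
  - by rewrite (_ : Ordinal _ = lift ord0 ord0) //; exact: val_inj.
  - by rewrite (_ : Ordinal _ = lift ord0 (lift ord0 ord0)) //; exact: val_inj.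
have [Y13 e13] := sum13; have [Y23 e23] := sum23; have [Y123 e123] := sum123.
case: ifP => _; case: ifP => _; case: ifP => _ // _;
  rewrite ?add0r ?addr0 ?addrA.
- by apply: not_double e123 _ x; rewrite !inE eqxx !orbT.
- by apply: not_double sum12 _ x; rewrite !inE eqxx !orbT.
- by apply: not_double e13 _ x; rewrite !inE eqxx !orbT.
- by apply: not_double (erefl : sval P1 = _) _ x; rewrite !inE eqxx.
- by apply: not_double e23 _ x; rewrite !inE eqxx !orbT.
- by apply: not_double (erefl : sval P2 = _) _ x; rewrite !inE eqxx !orbT.
- by apply: not_double (erefl : sval P3 = _) _ x; rewrite !inE eqxx !orbT.
Qed.

End ThreePoints.

(** * Excluding roots modulo 5, 13 and 17 *)

(** A rational root of a monic integral polynomial is an algebraic integer,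
    hence an integer, and reduces to a root modulo q. *)
Lemma no_rat_root_modp (q : nat) (p : {poly int}) : prime q -> p \is monic ->
  (forall y : 'F_q, ~~ root (map_poly intr p) y) ->
  forall x : rat, ~~ root (map_poly intr p) x.
Proof.
move=> q_pr p_mon nr x; apply/negP => px.
have /intrP[m xm] : (ratr x : algC) \is a Num.int.
  apply: Cint_rat_Aint; first exact: Crat_rat.
  have rx : root (map_poly intr p : {poly algC}) (ratr x).
    have -> : map_poly intr p =
        map_poly ratr (map_poly (intr : int -> rat) p) :> {poly algC}.
      by rewrite -map_poly_comp; apply: eq_map_poly => z /=; rewrite ratr_int.
    by rewrite fmorph_root.
  apply: root_monic_Aint rx _ _; first exact: monic_map.
  by apply/polyOverP => i; rewrite coef_map /= intr_int.
have {}xm : x = m%:~R.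
  by apply: (fmorph_inj (ratr : rat -> algC)); rewrite /= xm ratr_int.
have /eqP pm : root p m.
  by move: px; rewrite xm /root horner_map intr_eq0.
by have := nr m%:~R; rewrite /root horner_map pm rmorph0 eqxx.
Qed.

(** The enumeration is over natural numbers, and the conditions below are
    written without polynomials, so that they can be decided by computation. *)
Definition holds_on_Fp q (P : pred 'F_q) : bool :=
  all (fun i => P (inZp i)) (iota 0 (Zp_trunc (pdiv q)).+2).

Lemma holds_on_FpP q (P : pred 'F_q) : holds_on_Fp P -> forall y, P y.
Proof.
move=> /allP h y; have := h (val y); rewrite mem_iota ltn_ord => /(_ isT).
by rewrite valZpK.
Qed.

Definition weierstrass_free q (a b : 'F_q) : bool :=
  holds_on_Fp (fun y => y ^+ 3 + a * y + b != 0).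

Definition halving_free q (a b X : 'F_q) : bool :=
  holds_on_Fp (fun y => y ^+ 4 - 2 * a * y ^+ 2 - 8 * b * y + a ^+ 2
      - 4 * X * (y ^+ 3 + a * y + b) != 0).

(** The coefficients a, b of the curve of parameter t = (s^2-2)/(2s), scaled to
    a D^4 and b D^6 with D = 2 s e.  The factor 2 s clears the denominator of t,
    and e is meant to clear what remains in the abscissa of a point. *)
Definition twist_a {R : comNzRingType} (s e : R) : R :=
  - ((s ^+ 2 - 2) ^+ 2 - (2 * s) ^+ 2) ^+ 2 * e ^+ 4.
Definition twist_b {R : comNzRingType} (s e : R) : R :=
  4 * (s ^+ 2 - 2) ^+ 2 * (2 * s) ^+ 4 * e ^+ 6.

Lemma map_twist_a (R : comNzRingType) (s e : int) :
  (twist_a s e)%:~R = twist_a s%:~R e%:~R :> R.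
Proof. by rewrite /twist_a !(rmorphM, rmorphN, rmorphXn, rmorphB). Qed.

Lemma map_twist_b (R : comNzRingType) (s e : int) :
  (twist_b s e)%:~R = twist_b s%:~R e%:~R :> R.
Proof. by rewrite /twist_b !(rmorphM, rmorphN, rmorphXn, rmorphB). Qed.

Section ScaledCurve.
Variables (s : int) (s_neq0 : s != 0).
Local Notation d := (2 * s%:~R : rat).
Local Notation t := (conic_t s%:~R).
Local Notation a := (- (t ^+ 2 - 1) ^+ 2).
Local Notation b := ((2 * t) ^+ 2).

Lemma twist_coefs (e : int) :
  (twist_a s e)%:~R = a * (d * e%:~R) ^+ 4 /\
  (twist_b s e)%:~R = b * (d * e%:~R) ^+ 6.
Proof.
have ds : s%:~R != 0 :> rat by rewrite intr_eq0.
by rewrite map_twist_a map_twist_b /conic_t /twist_a /twist_b; split; field.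
Qed.

(** If x is a root of the quartic, then D^2 x with D = 2 s e is a root of a monic
    quartic with integral coefficients, because D^2 X is an integer N. *)
Lemma halving_no_root q (e N : int) (X : rat) (s' e' N' : 'F_q) : prime q ->
    X * (d * e%:~R) ^+ 2 = N%:~R ->
    s%:~R = s' -> e%:~R = e' -> N%:~R = N' ->
    halving_free (twist_a s' e') (twist_b s' e') N' ->
  forall x : rat, ~~ root (halving_poly a b X) x.
Proof.
rewrite /halving_free => q_pr eX <- <- <- /holds_on_FpP nr x.
have [eA eB] := twist_coefs e.
have h (y : 'F_q) :
    ~~ root (map_poly intr (halving_poly (twist_a s e) (twist_b s e) N)) y.
  by rewrite map_halving rootE horner_halving map_twist_a map_twist_b nr.
have := no_rat_root_modp q_pr (halving_monic _ _ _) h ((d * e%:~R) ^+ 2 * x).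
apply: contra; rewrite map_halving !rootE !horner_halving eA eB -eX => /eqP e0.
by apply/eqP; rewrite -[RHS](mulr0 ((d * e%:~R) ^+ 8)) -e0; ring.
Qed.

Lemma weierstrass_no_root q (s' : 'F_q) : prime q -> s%:~R = s' ->
    weierstrass_free (twist_a s' 1) (twist_b s' 1) ->
  forall x : rat, ~~ root (weierstrass_poly a b) x.
Proof.
rewrite /weierstrass_free => q_pr <- /holds_on_FpP nr x.
have [eA eB] := twist_coefs 1.
have h (y : 'F_q) :
    ~~ root (map_poly intr (weierstrass_poly (twist_a s 1) (twist_b s 1))) y.
  by rewrite map_weierstrass rootE horner_weierstrass map_twist_a map_twist_b nr.
have := no_rat_root_modp q_pr (weierstrass_monic _ _) h (d ^+ 2 * x).
apply: contra.
rewrite map_weierstrass !rootE !horner_weierstrass eA eB => /eqP e.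
by apply/eqP; rewrite -[RHS](mulr0 (d ^+ 6)) -e; ring.
Qed.

End ScaledCurve.

(** The numerators of t and w - 2 over the denominator 2 s; besides 2 s they are
    the only factors of the denominators in [sum_abscissas]. *)
Definition tau {R : comNzRingType} (s : R) : R := s ^+ 2 - 2.

Definition sigma {R : comNzRingType} (s : R) : R := s ^+ 2 + 2 - 4 * s.

Section Congruences.
Variable s : int.
Hypotheses (s_ge : 61 <= s) (s5 : s%:~R = 1 :> 'F_5)
  (s13 : s%:~R = 9 :> 'F_13) (s17 : s%:~R = 10 :> 'F_17).
Local Notation t := (conic_t s%:~R).
Local Notation w := (conic_w s%:~R).
Local Notation a := (- (t ^+ 2 - 1) ^+ 2).
Local Notation b := ((2 * t) ^+ 2).

Let s_neq0 : s != 0.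
Proof. by move: s_ge; lia. Qed.

Let s_ge_rat : 61 <= s%:~R :> rat.
Proof. by rewrite -[61]/(61%:~R) ler_int. Qed.

Let sR_neq0 : s%:~R != 0 :> rat.
Proof. by rewrite intr_eq0. Qed.

Let t_gt2 : 2 < t.
Proof.
by rewrite /conic_t; move: s%:~R s_ge_rat => x x_ge; rewrite ltr_pdivlMr; nra.
Qed.

Let tau_neq0 : s%:~R ^+ 2 - 2 != 0 :> rat.
Proof.
by move: s%:~R s_ge_rat => x x_ge; rewrite gt_eqF; nra.
Qed.

Let sigma_neq0 : s%:~R ^+ 2 + 2 - 4 * s%:~R != 0 :> rat.
Proof.
by move: s%:~R s_ge_rat => x x_ge; rewrite gt_eqF; nra.
Qed.

Lemma member_no_root x : ~~ root (weierstrass_poly a b) x.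
Proof. by apply: (@weierstrass_no_root s s_neq0 5 1); vm_compute. Qed.

Let no_half1 x : ~~ root (halving_poly a b 0) x.
Proof.
have free : @halving_free 17 (twist_a 10 1) (twist_b 10 1) 0 by vm_compute.
apply: (@halving_no_root _ s_neq0 17 1 0 _ _ _ _ isT _ s17 _ _ free).
- by rewrite mul0r.
- by [].
- by [].
Qed.

Let no_half2 x :
  ~~ root (halving_poly a b (t ^+ 2 - 1)) x.
Proof.
have free : @halving_free 17 (twist_a 10 1) (twist_b 10 1)
  (tau 10 ^+ 2 - (2 * 10) ^+ 2) by vm_compute.
apply: (@halving_no_root _ s_neq0 17 1
  (tau s ^+ 2 - (2 * s) ^+ 2) _ _ _ _ isT _ s17 _ _ free).
- by rewrite /conic_t /conic_w /tau /sigma; field.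
- by [].
- by rewrite -s17 /tau /sigma; ring.
Qed.

Let no_half12 x :
  ~~ root (halving_poly a b (1 - t ^+ 2)) x.
Proof.
have free : @halving_free 13 (twist_a 9 1) (twist_b 9 1)
  ((2 * 9) ^+ 2 - tau 9 ^+ 2) by vm_compute.
apply: (@halving_no_root _ s_neq0 13 1
  ((2 * s) ^+ 2 - tau s ^+ 2) _ _ _ _ isT _ s13 _ _ free).
- by rewrite /conic_t /conic_w /tau /sigma; field.
- by [].
- by rewrite -s13 /tau /sigma; ring.
Qed.

Let no_half3 x :
  ~~ root (halving_poly a b (- 1)) x.
Proof.
have free : @halving_free 17 (twist_a 10 1) (twist_b 10 1)
  (- (2 * 10) ^+ 2) by vm_compute.
apply: (@halving_no_root _ s_neq0 17 1
  (- (2 * s) ^+ 2) _ _ _ _ isT _ s17 _ _ free).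
- by ring.
- by [].
- by rewrite -s17 /tau /sigma; ring.
Qed.

Let no_half13 x :
  ~~ root (halving_poly a b (t ^+ 2 * (2 - w) ^+ 2 + 1)) x.
Proof.
have free : @halving_free 17 (twist_a 10 (2 * 10)) (twist_b 10 (2 * 10))
  (tau 10 ^+ 2 * sigma 10 ^+ 2 + (2 * 10) ^+ 4) by vm_compute.
apply: (@halving_no_root _ s_neq0 17 (2 * s)
  (tau s ^+ 2 * sigma s ^+ 2 + (2 * s) ^+ 4) _ _ _ _ isT _ s17 _ _ free).
- by rewrite /conic_t /conic_w /tau /sigma; field.
- by rewrite -s17 /tau /sigma; ring.
- by rewrite -s17 /tau /sigma; ring.
Qed.

Let no_half23 x :
  ~~ root (halving_poly a b ((2 - w) ^+ 2 / t ^+ 2 + 2 - t ^+ 2)) x.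
Proof.
have free : @halving_free 17 (twist_a 10 (tau 10)) (twist_b 10 (tau 10))
  (sigma 10 ^+ 2 * (2 * 10) ^+ 2
   + (2 * (2 * 10) ^+ 2 - tau 10 ^+ 2) * tau 10 ^+ 2) by vm_compute.
apply: (@halving_no_root _ s_neq0 17 (tau s)
  (sigma s ^+ 2 * (2 * s) ^+ 2
   + (2 * (2 * s) ^+ 2 - tau s ^+ 2) * tau s ^+ 2) _ _ _ _ isT _ s17 _ _ free).
- rewrite /conic_t /conic_w /tau /sigma; field.
  by apply/andP; split; [exact: sR_neq0 | exact: tau_neq0].
- by rewrite -s17 /tau /sigma; ring.
- by rewrite -s17 /tau /sigma; ring.
Qed.

Let no_half123 x :
  ~~ root (halving_poly a b (t ^+ 2 / (w - 2) ^+ 2 + t ^+ 2)) x.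
Proof.
have free : @halving_free 17 (twist_a 10 (sigma 10)) (twist_b 10 (sigma 10))
  (tau 10 ^+ 2 * (2 * 10) ^+ 2 + tau 10 ^+ 2 * sigma 10 ^+ 2) by vm_compute.
apply: (@halving_no_root _ s_neq0 17 (sigma s)
  (tau s ^+ 2 * (2 * s) ^+ 2 + tau s ^+ 2 * sigma s ^+ 2) _ _ _ _ isT _ s17 _ _ free).
- rewrite /conic_t /conic_w /tau /sigma; field.
  apply/andP; split; first exact: sR_neq0.
  by rewrite (_ : _ + _ = s%:~R ^+ 2 + 2 - 4 * s%:~R); [exact: sigma_neq0 | ring].
- by rewrite -s17 /tau /sigma; ring.
- by rewrite -s17 /tau /sigma; ring.
Qed.

Lemma no_half_sums X : X \in sum_abscissas t w ->
  forall x, ~~ root (halving_poly a b X) x.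
Proof.
rewrite /sum_abscissas => + x.
rewrite inE => /predU1P[->|]; first exact: no_half1.
rewrite inE => /predU1P[->|]; first exact: no_half2.
rewrite inE => /predU1P[->|]; first exact: no_half12.
rewrite inE => /predU1P[->|]; first exact: no_half3.
rewrite inE => /predU1P[->|]; first exact: no_half13.
rewrite inE => /predU1P[->|]; first exact: no_half23.
by rewrite inE => /eqP ->; exact: no_half123.
Qed.

Lemma member_rank : rank_ge a b 3.
Proof.
apply: (@three_points_rank t w).
- exact: t_gt2.
- have -> : w - 2 = (s%:~R ^+ 2 + 2 - 4 * s%:~R) / (2 * s%:~R).
    by rewrite /conic_w; field.
  rewrite mulf_neq0 ?invr_neq0 ?mulf_neq0 //; exact: sigma_neq0.
- by rewrite /conic_t /conic_w; field.
- exact: member_no_root.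
- exact: no_half_sums.
Qed.

End Congruences.

(** On nonzero rationals s and -2/s have the same image, so positivity
    is what makes the parametrization injective. *)
Lemma conic_t_inj : {in Num.pos &, injective conic_t}.
Proof.
move=> x y; rewrite !posrE => x0 y0 /eqP.
have x2 : 2 * x != 0 by rewrite mulf_neq0 // gt_eqF.
have y2 : 2 * y != 0 by rewrite mulf_neq0 // gt_eqF.
rewrite /conic_t (eqr_div _ _ x2 y2) -subr_eq0 => /eqP e.
have /eqP : (x - y) * (x * y + 2) = 0.
  by apply: (mulIf (isT : (2 : rat) != 0)); rewrite mul0r -e; ring.
rewrite mulf_eq0 subr_eq0 => /orP[/eqP //|].
by rewrite gt_eqF // addr_gt0 // mulr_gt0.
Qed.

Theorem theorem3p1 :
  infinite_set
    [set t : rat | elliptic (- (t ^+ 2 - 1) ^+ 2) ((2 * t) ^+ 2) /\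
                   rank_ge (- (t ^+ 2 - 1) ^+ 2) ((2 * t) ^+ 2) 3].
Proof.
(* 61 is 1 mod 5, 9 mod 13 and 10 mod 17, and 1105 = 5 * 13 * 17. *)
pose s (k : nat) : int := 61 + 1105 * k%:Z.
have s_ge k : 61 <= s k by rewrite /s; lia.
have t_inj : injective (fun k => conic_t (s k)%:~R).
  move=> k l /conic_t_inj; rewrite !posrE !ltr0z => e.
  have /intr_inj : (s k)%:~R = (s l)%:~R :> rat.
    by apply: e; [move: (s_ge k) | move: (s_ge l)]; lia.
  by rewrite /s; lia.
move=> fin; apply: infinite_nat.
apply: sub_finite_set (finite_preimage (in2W t_inj) fin) => k _ /=.
have sE q c : (1105 : 'F_q) = 0 -> (61 : 'F_q) = c -> (s k)%:~R = c.
  by move=> e0 <-; rewrite /s rmorphD rmorphM !rmorph_nat e0 mul0r addr0.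
have [s5 s13 s17] : [/\ (s k)%:~R = 1 :> 'F_5, (s k)%:~R = 9 :> 'F_13
                       & (s k)%:~R = 10 :> 'F_17].
  by split; apply: sE; apply: val_inj; vm_compute.
split; last exact: member_rank (s_ge k) s5 s13 s17.
exact: no_root_elliptic (member_no_root (s_ge k) s5).
Qed.
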